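(* Let $G$ be a topological Abelian group. Suppose that there exists a dense subgroup $A\leq G$ such that $A\in S_{TG}(\mathbb{T})$. Then $G\in S_{TG}(\mathbb{T})$.
   Context: $\mathbb{T}$ denotes the unit circle of $\mathbb{C}$ with its usual topology and multiplication. A twisted sum of topological Abelian groups is a short exact sequence $0\to Y\stackrel{\imath}{\to} X\stackrel{\pi}{\to} Z\to 0$ of topological Abelian groups and continuous homomorphisms in which $\imath$ and $\pi$ are open onto their images. It splits if there is a continuous homomorphism $\Phi:X\to Y\times Z$ such that $\Phi\circ\imath$ is the canonical inclusion $y\mapsto (y,0)$ and $\pi_Z\circ\Phi=\pi$, where $\pi_Z:Y\times Z\to Z$ is the projection (such $\Phi$ is necessarily a topological isomorphism). A topological Abelian group $G$ belongs to $S_{TG}(\mathbb{T})$ if every twisted sum of topological Abelian groups $0\to\mathbb{T}\to X\to G\to 0$ splits. Subgroups carry the induced topology. *)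

(* Defs.v *)
From HB Require Import structures.
From mathcomp Require Import all_boot all_order all_algebra.
From mathcomp Require Import all_classical all_reals all_analysis.
From mathcomp Require Import complex.

Set Implicit Arguments.
Unset Strict Implicit.
Unset Printing Implicit Defensive.

Import Order.TTheory GRing.Theory Num.Theory.
Import numFieldNormedType.Exports.

Local Open Scope classical_set_scope.
Local Open Scope ring_scope.

(* The unit circle of R[i]. Topological Abelian groups are topologicalZmodType,
   hence written additively: x + y in [circle R] is the product of x and y in
   R[i], 0 is 1 and - x is the inverse x^-1. The topology is induced by that of
   R[i]^o, the type R[i] with the topology of its norm. *)
Record circle (R : realType) :=
  Circle { circle_val :> R[i]; _ : `|circle_val| == 1 }.

HB.instance Definition _ (R : realType) := [isSub of circle R for @circle_val R].
HB.instance Definition _ (R : realType) := [Choice of circle R by <:].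

Section CircleGroup.
Variable R : realType.
Implicit Types x y z : circle R.

Lemma circle_norm x : `|val x| = 1.
Proof. by case: x => x /= /eqP. Qed.

Lemma circle_neq0 x : val x != 0.
Proof. by rewrite -normr_eq0 circle_norm oner_eq0. Qed.

Fact circle_one_subproof : `|1 : R[i]| == 1.
Proof. by rewrite normr1. Qed.

Fact circle_mul_subproof x y : `|val x * val y| == 1.
Proof. by rewrite normrM !circle_norm mulr1. Qed.

Fact circle_inv_subproof x : `|(val x)^-1| == 1.
Proof. by rewrite normfV circle_norm invr1. Qed.

Definition circle_one : circle R := Circle circle_one_subproof.
Definition circle_mul x y : circle R := Circle (circle_mul_subproof x y).
Definition circle_inv x : circle R := Circle (circle_inv_subproof x).

Fact circle_mulA : associative circle_mul.
Proof. by move=> x y z; apply: val_inj; rewrite /= mulrA. Qed.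

Fact circle_mulC : commutative circle_mul.
Proof. by move=> x y; apply: val_inj; rewrite /= mulrC. Qed.

Fact circle_mul1 : left_id circle_one circle_mul.
Proof. by move=> x; apply: val_inj; rewrite /= mul1r. Qed.

Fact circle_mulV : left_inverse circle_one circle_inv circle_mul.
Proof. by move=> x; apply: val_inj; rewrite /= mulVf // circle_neq0. Qed.

HB.instance Definition _ := GRing.isZmodule.Build (circle R)
  circle_mulA circle_mulC circle_mul1 circle_mulV.

HB.instance Definition _ :=
  Topological.copy (circle R)
    (initial_topology (@circle_val R : circle R -> R[i]^o)).

Lemma circle_val_continuous : continuous (@circle_val R : circle R -> R[i]^o).
Proof. exact: initial_continuous. Qed.

Fact circle_sub_continuous :
  continuous (fun x : circle R * circle R => x.1 - x.2).
Proof.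
apply/continuous_comp_initial => x.
apply: (@cvgM _ _ _ _ (fun x : circle R * circle R => circle_val x.1)
          (fun x : circle R * circle R => (circle_val x.2)^-1)).
  by apply: continuous_comp; [exact: cvg_fst|exact: circle_val_continuous].
apply: cvgV; first exact: circle_neq0.
by apply: continuous_comp; [exact: cvg_snd|exact: circle_val_continuous].
Qed.

HB.instance Definition _ :=
  PreTopologicalNmodule_isTopologicalZmodule.Build (circle R)
    circle_sub_continuous.

End CircleGroup.

Record subgroup (G : topologicalZmodType) (A : zmodClosed G) :=
  Subgroup { subgroup_val :> G; _ : subgroup_val \in A }.

HB.instance Definition _ (G : topologicalZmodType) (A : zmodClosed G) :=
  [isSub of subgroup A for @subgroup_val G A].
HB.instance Definition _ (G : topologicalZmodType) (A : zmodClosed G) :=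
  [Choice of subgroup A by <:].
HB.instance Definition _ (G : topologicalZmodType) (A : zmodClosed G) :=
  [SubChoice_isSubZmodule of subgroup A by <:].
HB.instance Definition _ (G : topologicalZmodType) (A : zmodClosed G) :=
  Topological.copy (subgroup A) (initial_topology (@subgroup_val G A)).

Section SubgroupTopology.
Variables (G : topologicalZmodType) (A : zmodClosed G).

Lemma subgroup_val_continuous : continuous (@subgroup_val G A).
Proof. exact: initial_continuous. Qed.

Fact subgroup_sub_continuous :
  continuous (fun x : subgroup A * subgroup A => x.1 - x.2).
Proof.
apply/continuous_comp_initial => x.
apply: (@continuous_comp _ _ _
  (fun x : subgroup A * subgroup A => (subgroup_val x.1, subgroup_val x.2))
  (fun x : G * G => x.1 - x.2)); last exact: sub_continuous.
apply: cvg_pair.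
  by apply: continuous_comp; [exact: cvg_fst|exact: subgroup_val_continuous].
by apply: continuous_comp; [exact: cvg_snd|exact: subgroup_val_continuous].
Qed.

HB.instance Definition _ :=
  PreTopologicalNmodule_isTopologicalZmodule.Build (subgroup A)
    subgroup_sub_continuous.

End SubgroupTopology.

Definition open_onto_image (X Y : topologicalType) (f : X -> Y) : Prop :=
  forall U : set X, open U -> exists2 V : set Y, open V & f @` U = V `&` range f.

Definition short_exact (Y X Z : zmodType)
    (i : {additive Y -> X}) (p : {additive X -> Z}) : Prop :=
  [/\ injective i, range i = [set x | p x = 0] & range p = setT].

Definition twisted_sum (Y X Z : topologicalZmodType)
    (i : {additive Y -> X}) (p : {additive X -> Z}) : Prop :=
  [/\ short_exact i p, continuous i, continuous p,
      open_onto_image i & open_onto_image p].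

Definition splits (Y X Z : topologicalZmodType)
    (i : {additive Y -> X}) (p : {additive X -> Z}) : Prop :=
  exists Phi : {additive X -> Y * Z},
    [/\ continuous Phi, forall y, Phi (i y) = (y, 0)
      & forall x, (Phi x).2 = p x].

(* [S_TG Y G] : the group G belongs to the class S_TG(Y). *)
Definition S_TG (Y G : topologicalZmodType) : Prop :=
  forall (X : topologicalZmodType)
    (i : {additive Y -> X}) (p : {additive X -> G}),
    twisted_sum i p -> splits i p.

(* Main.v *)
Require Import Defs.
From HB Require Import structures.
From mathcomp Require Import all_boot all_order all_algebra.
From mathcomp Require Import all_classical all_reals all_analysis.
From mathcomp Require Import complex.

Set Implicit Arguments.
Unset Strict Implicit.
Unset Printing Implicit Defensive.

Import Order.TTheory GRing.Theory Num.Theory.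
Import numFieldNormedType.Exports.

Local Open Scope classical_set_scope.
Local Open Scope ring_scope.

(** Let 0 -> Y -> X -> G -> 0 be a twisted sum, with inclusion i and quotient
map p, and let H := p^-1(A). Restricting i and p gives a twisted sum
0 -> Y -> H -> A -> 0 ([twisted_sum_restrict]), which splits by assumption; the
first component of its splitting is a continuous homomorphism chi : H -> Y that
is a left inverse of i. Since p is open and A is dense in G, the subgroup H is
dense in X ([dense_preim]). When Y is complete and Hausdorff, chi extends to a
continuous homomorphism r : X -> Y ([extend_hom]). As i takes its values in H,
on which r and chi agree, r is still a left inverse of i, and x |-> (r x, p x)
splits the original sequence ([splits_of_retraction]).

The circle enters only through being complete and Hausdorff. Completeness is
read off from that of the real line: on the circle the group-theoretic
difference s / t is close to 1 exactly when s is close to t in the complex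
plane, because |t| = 1, so a Cauchy filter has Cauchy real and imaginary
parts; the complex limit has modulus 1 by continuity of the norm. *)

(** * Extension by density *)

(** If U - W is contained in V for neighbourhoods U of a and W of 0, then the
closure of U is already contained in V: a point y of the closure has some
z in U with z - y in W, and y = z - (z - y). *)
Lemma topological_group_regular (G : topologicalZmodType) : regular_space G.
Proof.
move=> a V aV.
have /= : nbhs ((a, 0) : G * G) ((fun x : G * G => x.1 - x.2) @^-1` V).
  by apply: (@sub_continuous G (a, 0)); rewrite /= subr0.
move=> [[U W] [/= aU W0] UWV]; exists U => // y /(_ [set z | W (z - y)]) [].
  have : (fun z => z - y) @ nbhs y --> (0 : G).
    rewrite -(subrr y).
    apply: (@continuous_comp _ _ _ (fun z => (z, y))
              (fun x : G * G => x.1 - x.2)); last exact: sub_continuous.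
    by apply: cvg_pair; [exact: cvg_id|exact: cvg_cst].
  by apply.
move=> z [Uz Wzy]; have := UWV (z, z - y); rewrite /= subKr; exact.
Qed.

(** The inverse image of a filter along j, that is, its trace on D when j is the
inclusion of a subspace. *)
Definition trace_filter (D T : Type) (j : D -> T) (F : set_system T) :
  set_system D := filter_from F (preimage j).

Lemma trace_filter_filter (D T : Type) (j : D -> T) (F : set_system T) :
  Filter F -> Filter (trace_filter j F).
Proof.
move=> FF; apply: filter_from_filter; first by exists setT; exact: filterT.
by move=> U V FU FV; exists (U `&` V); first exact: filterI.
Qed.

Lemma trace_filter_proper (D : Type) (T : topologicalType) (j : D -> T)
    (x : T) : dense (range j) -> ProperFilter (trace_filter j (nbhs x)).
Proof.
move=> jD; apply: filter_from_proper; first exact: trace_filter_filter.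
move=> U; rewrite nbhsE => -[N [oN Nx] NU].
have [y [Ny [d _ jd]]] := jD N (ex_intro _ x Nx) oN.
by exists d; rewrite /= jd; exact: NU.
Qed.

(** A closed neighbourhood C of g x contains f d for all d near x. If y is close
enough to x, the points d near y are also near x, so g y, being a limit of
such values f d, stays in C. Regularity supplies the closed neighbourhood. *)
Lemma extension_continuous (D : Type) (T Y : topologicalType) (j : D -> T)
    (f : D -> Y) (g : T -> Y) : dense (range j) -> regular_space Y ->
  (forall x, f @ trace_filter j (nbhs x) --> g x) -> continuous g.
Proof.
move=> jD regY fg x V /regY [C gxC CV].
have [U xU UC] := fg x C gxC.
suff : nbhs x (g @^-1` V) by [].
move: xU; rewrite !nbhsE => -[N [oN Nx] NU]; exists N => // y Ny.
apply: CV => B gyB.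
have [U' yU' U'B] := fg y B gyB.
have yN : nbhs y N by exact: open_nbhs_nbhs.
have FF := trace_filter_proper y jD.
have : trace_filter j (nbhs y) (j @^-1` (N `&` U')).
  by exists (N `&` U') => //; exact: filterI.
move=> /filter_ex[d [Nd U'd]]; exists (f d); split; last exact: U'B.
by apply: UC; exact: NU.
Qed.

(** Cauchy filters for the canonical uniformity of the group. This is spelled
out because a topological Abelian group does not carry a uniform structure as
part of its type. *)
Definition group_cauchy (Y : topologicalZmodType) (F : set_system Y) :=
  forall W, nbhs (0 : Y) W ->
    exists2 S, F S & forall s t, S s -> S t -> W (s - t).

Definition complete_group (Y : topologicalZmodType) :=
  forall F : set_system Y, ProperFilter F -> group_cauchy F ->
    exists y : Y, F --> y.

(** The link between continuity on a subgroup and limits along traces of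
neighbourhood filters of the ambient group. *)
Lemma nbhs_subgroup (G : topologicalZmodType) (H : zmodClosed G)
    (h : subgroup H) : nbhs h = trace_filter (@subgroup_val G H) (nbhs (val h)).
Proof.
apply/seteqP; split=> S.
  rewrite nbhsE => -[_ [[V oV <-] Vh] VS]; exists V => //.
  exact: open_nbhs_nbhs.
by case=> U hU US; apply: filterS US _; exact: subgroup_val_continuous hU.
Qed.

(** A continuous homomorphism is uniformly continuous: a neighbourhood V of 0
whose trace on H is sent into W, and a neighbourhood U of x with U - U inside
V, give differences of values on the trace of U lying in W. *)
Lemma hom_trace_cauchy (X Y : topologicalZmodType) (H : zmodClosed X)
    (f : {additive subgroup H -> Y}) (x : X) : continuous f ->
  group_cauchy (f @ trace_filter (@subgroup_val X H) (nbhs x)).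
Proof.
move=> fC W W0.
have : nbhs (0 : subgroup H) (f @^-1` W) by apply: fC; rewrite raddf0.
rewrite nbhs_subgroup => -[V V0 VW].
have /= [[U1 U2] [/= xU1 xU2] UV] :
    nbhs (x, x) ((fun x : X * X => x.1 - x.2) @^-1` V).
  by apply: (@sub_continuous X (x, x)); rewrite /= subrr.
exists (f @` (@subgroup_val X H @^-1` (U1 `&` U2))).
  by exists (U1 `&` U2); [exact: filterI|move=> h Uh; exists h].
move=> _ _ [h [U1h _] <-] [k [_ U2k] <-]; rewrite -raddfB; apply: VW.
exact: (UV (_, _)).
Qed.

(** The limits of f along the traces of neighbourhoods define g; continuity
comes from the regularity of Y, and additivity from its being Hausdorff, since
g (x - y) and g x - g y are continuous in (x, y) and agree on the dense
subset H * H. *)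
Lemma extend_hom (X Y : topologicalZmodType) (H : zmodClosed X)
    (f : {additive subgroup H -> Y}) :
  hausdorff_space Y -> complete_group Y -> dense [set x | x \in H] ->
  continuous f ->
  exists2 g : {additive X -> Y}, continuous g & forall h, g (val h) = f h.
Proof.
move=> hY cY Hd fC; pose j := @subgroup_val X H.
have jD : dense (range j).
  move=> N N0 oN; have [x [Nx Hx]] := Hd N N0 oN.
  by exists x; split => //; exists (Subgroup Hx).
have FF x := trace_filter_proper x jD.
have [g fg] : {g : X -> Y & forall x, f @ trace_filter j (nbhs x) --> g x}.
  apply: (@choice X Y (fun x y => f @ trace_filter j (nbhs x) --> y)) => x.
  by apply: cY; exact: hom_trace_cauchy.
have gC : continuous g.
  by apply: extension_continuous jD _ fg; exact: topological_group_regular.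
have gf h : g (val h) = f h.
  apply: (cvg_unique _ (fg (val h))) => //.
  by rewrite -nbhs_subgroup; exact: fC.
have gB : zmod_morphism g.
  (* Any neighbourhoods A of g (x - y) and B of g x - g y have a common point:
     evaluate both expressions at members h, k of H close to x and y. *)
  move=> x y; apply: hY => A B gxyA gxyB.
  have /= : nbhs (x, y) ((fun x : X * X => x.1 - x.2) @^-1` (g @^-1` A)).
    by apply: (@sub_continuous X (x, y)); exact: gC.
  move=> [[U1 U2] [/= xU1 yU2] UA].
  have /= : nbhs (x, y) ((fun x : X * X => (g x.1, g x.2)) @^-1`
                          ((fun x : Y * Y => x.1 - x.2) @^-1` B)).
    have : {for (x, y), continuous (fun x : X * X => (g x.1, g x.2))}.
      apply: cvg_pair.
        by apply: continuous_comp; [exact: cvg_fst|exact: gC].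
      by apply: continuous_comp; [exact: cvg_snd|exact: gC].
    by apply; apply: (@sub_continuous Y (g x, g y)).
  move=> [[V1 V2] [/= xV1 yV2] VB].
  have [h [U1h V1h]] : exists h : subgroup H, (U1 `&` V1) (j h).
    apply: (@filter_ex _ (trace_filter j (nbhs x)) _ (j @^-1` (U1 `&` V1))).
    by exists (U1 `&` V1) => //; exact: filterI.
  have [k [U2k V2k]] : exists k : subgroup H, (U2 `&` V2) (j k).
    apply: (@filter_ex _ (trace_filter j (nbhs y)) _ (j @^-1` (U2 `&` V2))).
    by exists (U2 `&` V2) => //; exact: filterI.
  exists (g (j h - j k)); split; first exact: (UA (_, _)).
  have -> : g (j h - j k) = g (j h) - g (j k).
    by rewrite -[j h - j k]/(val (h - k)) !gf raddfB.
  exact: (VB (_, _)).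
pose m := GRing.isZmodMorphism.Build X Y g gB.
pose g' : {additive X -> Y} := HB.pack g m.
by exists g'.
Qed.

(** * The circle is a complete Hausdorff group *)

Section CircleComplete.
Variable R : realType.

Lemma circle_cvg (F : set_system (circle R)) (x : circle R) : Filter F ->
  (@circle_val R : circle R -> R[i]^o) @ F --> (circle_val x : R[i]^o) ->
  F --> x.
Proof.
move=> FF vF A; rewrite nbhsE => -[_ [[V oV <-] Vx] VA].
by apply: filterS VA _; apply: vF; exact: open_nbhs_nbhs.
Qed.

Lemma circle_hausdorff : hausdorff_space (circle R).
Proof.
move=> x y xy; apply: val_inj; apply: (@norm_hausdorff _ R[i]^o) => A B xA yB.
have [] := xy (@circle_val R @^-1` A) (@circle_val R @^-1` B).
- exact: circle_val_continuous.
- exact: circle_val_continuous.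
by move=> z [Az Bz]; exists (circle_val z).
Qed.

Lemma normCi : `|'i%C : R[i]| = 1.
Proof. by rewrite normc_def /= expr0n add0r expr1n sqrtr1. Qed.

Lemma normc_ge_Im (z : R[i]) : `|complex.Im z|%:C%C <= `|z|.
Proof.
rewrite -normrN -ReiNIm (le_trans (normc_ge_Re _))// normrM normCi.
by rewrite mulr1.
Qed.

Lemma cvg_complex (T : Type) (F : set_system T) (f : T -> R[i]) (a b : R) :
  Filter F ->
  (fun t => complex.Re (f t)) @ F --> a ->
  (fun t => complex.Im (f t)) @ F --> b ->
  (f : T -> R[i]^o) @ F --> ((a +i* b)%C : R[i]^o).
Proof.
move=> FF /cvgrPdist_lt fa /cvgrPdist_lt fb; apply/cvgrPdist_lt => e e0.
(* A positive e in R[i] is real, so it can be halved as a real number. *)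
have e2 : 0 < complex.Re e / 2.
  by move: e0; rewrite ltcE => /andP[_ ?]; rewrite divr_gt0.
have eE : e = (complex.Re e)%:C%C.
  by rewrite RRe_real // gtr0_real.
near=> t.
have -> : (a +i* b)%C - f t =
    (a - complex.Re (f t))%:C%C + 'i%C * (b - complex.Im (f t))%:C%C.
  by case: (f t) => c d; simpc.
rewrite (le_lt_trans (ler_normD _ _))// normrM normCi.
have normCr (x : R) : `|x%:C%C| = `|x|%:C%C.
  by rewrite normc_def /= expr0n addr0 sqrtr_sqr.
rewrite mul1r !normCr eE [complex.Re e]splitr.
rewrite rmorphD /= -/(real_complex R) ltrD // ltcR.
  by near: t; exact: fa.
by near: t; exact: fb.
Unshelve. all: by end_near. Qed.

Lemma circle_complete : complete_group (circle R).
Proof.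
move=> F FF Fc.
have dist (e : R) : 0 < e -> exists2 S, F S &
    forall s t, S s -> S t -> `|circle_val s - circle_val t| < e%:C%C.
  move=> e0; pose W := [set u : circle R | `|1 - circle_val u| < e%:C%C].
  have W0 : nbhs (0 : circle R) W.
    have := @circle_val_continuous R 0 => /cvgrPdist_lt; apply.
    by rewrite ltcR.
  have [S FS SW] := Fc W W0; exists S => // s t Ss St.
  (* The group is written additively: s - t is the quotient s / t in R[i]. *)
  have -> : circle_val s - circle_val t =
      - ((1 - circle_val (s - t)) * circle_val t).
    have -> : circle_val (s - t) = circle_val s / circle_val t by [].
    by rewrite mulrBl mul1r divfK ?opprB //; exact: circle_neq0.
  by rewrite normrN normrM (circle_norm t) mulr1; exact: SW.
have parts (h : R[i] -> R) : (forall z w, `|h z - h w|%:C%C <= `|z - w|) ->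
    exists a : R, (fun x => h (circle_val x)) @ F --> a.
  move=> hn; apply/cvg_ex.
  apply: (@cauchy_cvg R); apply/cauchy_ballP => e e0.
  have [S FS Se] := dist e e0.
  pose k x := h (circle_val x); pose T := k @` S.
  have FT : F (k @^-1` T) by apply: filterS FS => x Sx; exists x.
  exists (T, T) => // -[_ _] [/= [x Sx <-] [y Sy <-]].
  by rewrite /ball /= -ltcR (le_lt_trans (hn _ _))// Se.
have [a Fa] : exists a : R, (fun x => complex.Re (circle_val x)) @ F --> a.
  by apply: parts => z w; rewrite -raddfB; exact: normc_ge_Re.
have [b Fb] : exists b : R, (fun x => complex.Im (circle_val x)) @ F --> b.
  by apply: parts => z w; rewrite -raddfB; exact: normc_ge_Im.
have Fz := cvg_complex FF Fa Fb.
(* The norms converge to that of the limit while being constantly 1. *)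
have nz : `|(a +i* b)%C| == 1.
  have := cvg_norm Fz.
  under eq_fun do rewrite (circle_norm _).
  move=> /(_ FF) F1; apply/eqP.
  have FF1 := fmap_proper_filter (cst 1 : circle R -> R[i]^o) FF.
  apply: (@cvg_unique R[i]^o (@norm_hausdorff _ R[i]^o) _ FF1).
    exact: F1.
  exact: cvg_cst.
by exists (Circle nz); exact: circle_cvg.
Qed.

End CircleComplete.

(** * Restricting a twisted sum over a subgroup *)

Section Corestriction.
Variables (X Y : topologicalZmodType) (H : zmodClosed X).
Variables (f : {additive Y -> X}) (fH : forall y, f y \in H).

Definition corestrict (y : Y) : subgroup H := Subgroup (fH y).

Fact corestrict_is_zmod_morphism : zmod_morphism corestrict.
Proof. by move=> y z; apply: val_inj; rewrite /= raddfB. Qed.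

HB.instance Definition _ :=
  GRing.isZmodMorphism.Build Y (subgroup H) corestrict
    corestrict_is_zmod_morphism.

Lemma corestrict_continuous : continuous f -> continuous corestrict.
Proof. by move=> fC; exact/continuous_comp_initial. Qed.

End Corestriction.

Section PreimageSubgroup.
Variables (X G : topologicalZmodType) (p : {additive X -> G}).
Variable A : zmodClosed G.

Definition preim_subgroup : {pred X} := [pred x | p x \in A].

Fact preim_subgroup_zmod_closed : zmod_closed preim_subgroup.
Proof.
split=> [|x y]; rewrite !inE ?raddf0 ?rpred0 // raddfB; exact: rpredB.
Qed.

HB.instance Definition _ :=
  GRing.isZmodClosed.Build X preim_subgroup preim_subgroup_zmod_closed.

Definition restrict_over : {additive subgroup preim_subgroup -> subgroup A} :=
  @corestrict G (subgroup preim_subgroup) A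
    (p \o (val : subgroup preim_subgroup -> X)) (fun h => valP h).

End PreimageSubgroup.

(** Since p is open, the image of a nonempty open set is a nonempty open set,
hence meets A. *)
Lemma dense_preim (X G : topologicalZmodType) (p : {additive X -> G})
    (A : zmodClosed G) :
  open_onto_image p -> range p = setT -> dense [set x | x \in A] ->
  dense [set x | x \in preim_subgroup p A].
Proof.
move=> po pT Ad N [x Nx] oN; have [V oV pN] := po N oN.
rewrite pT setIT in pN.
have [|a [+ Aa]] := Ad V _ oV; first by exists (p x); rewrite -pN; exists x.
by rewrite -pN => -[z Nz pz]; exists z; split; rewrite //= inE pz.
Qed.

(** The kernel of p is contained in the preimage of A, so exactness survives.
For openness, i (U) is the trace on H of an open set of X meeting i (Y) in
i (U); and because H is saturated for p, the image of the trace of V on H is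
the trace of p (V) on A. *)
Lemma twisted_sum_restrict (Y X G : topologicalZmodType)
    (i : {additive Y -> X}) (p : {additive X -> G}) (A : zmodClosed G)
    (iH : forall y, i y \in preim_subgroup p A) :
  twisted_sum i p ->
  twisted_sum (corestrict iH : {additive _ -> _}) (restrict_over p A).
Proof.
move=> [[i_inj ip pT] iC pC io po]; split.
- split.
  + by move=> y z /(congr1 val) /i_inj.
  + apply/seteqP; split=> [_ [y _ <-]|h /(congr1 val) /= ph].
      apply: val_inj => /=.
      by have : range i (i y) by [exists y]; rewrite ip.
    have : range i (val h) by rewrite ip.
    by case=> y _ yh; exists y => //; exact: val_inj.
  + apply/seteqP; split=> // a _.
    have : range p (val a) by rewrite pT.
    case=> x _ pxa; have xH : x \in preim_subgroup p A.
      by rewrite inE pxa; exact: valP.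
    by exists (Subgroup xH) => //; exact: val_inj.
- exact: corestrict_continuous.
- apply: corestrict_continuous => h; apply: continuous_comp; last exact: pC.
  exact: subgroup_val_continuous.
- move=> U oU; have [V oV iU] := io U oU.
  exists (@subgroup_val X (preim_subgroup p A) @^-1` V); first by exists V.
  apply/seteqP; split=> [_ [y Uy <-]|h [Vh [y _ yh]]].
    split; last by exists y.
    by have : (i @` U) (i y) by [exists y]; rewrite iU => -[].
  have : (V `&` range i) (i y) by split; [move: Vh; rewrite -yh|exists y].
  by rewrite -iU => -[z Uz /i_inj zy]; exists z => //; rewrite zy.
- move=> _ [V oV <-]; have [W oW pV] := po V oV; rewrite pT setIT in pV.
  exists (@subgroup_val G A @^-1` W); first by exists W.
  apply/seteqP; split=> [_ [h Vh <-]|a [/= Wa _]].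
    split; last by exists h.
    by rewrite /= -pV; exists (val h).
  move: Wa; rewrite -pV => -[x Vx pxa].
  have xH : x \in preim_subgroup p A by rewrite inE pxa; exact: valP.
  by exists (Subgroup xH) => //; exact: val_inj.
Qed.

(** * Lifting the splitting *)

Lemma splits_of_retraction (Y X Z : topologicalZmodType)
    (i : {additive Y -> X}) (p : {additive X -> Z}) (r : {additive X -> Y}) :
  twisted_sum i p -> continuous r -> (forall y, r (i y) = y) -> splits i p.
Proof.
move=> [[_ ip _] _ pC _ _] rC ri.
pose Phi x := (r x, p x).
have PhiB : zmod_morphism Phi.
  by move=> x y; rewrite /Phi !raddfB.
pose m := GRing.isZmodMorphism.Build X (Y * Z)%type Phi PhiB.
pose Phi' : {additive X -> Y * Z} := HB.pack Phi m.
exists Phi'; split=> //.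
  by move=> x; apply: cvg_pair; [exact: rC|exact: pC].
move=> y; rewrite /= /Phi ri; congr pair.
by have : range i (i y) by [exists y]; rewrite ip.
Qed.

Lemma S_TG_dense (Y G : topologicalZmodType) (A : zmodClosed G) :
  hausdorff_space Y -> complete_group Y -> dense [set x | x \in A] ->
  S_TG Y (subgroup A) -> S_TG Y G.
Proof.
move=> hY cY Ad SA X i p ts; have [[i_inj ip pT] iC pC io po] := ts.
have iH y : i y \in preim_subgroup p A.
  have : range i (i y) by exists y.
  by rewrite ip inE => /= ->; exact: rpred0.
have [Phi [PhiC Phi_i _]] := SA _ _ _ (twisted_sum_restrict iH ts).
pose chi : {additive _ -> _} := fst \o Phi.
have chiC : continuous chi.
  by move=> h; apply: continuous_comp; [exact: PhiC|exact: cvg_fst].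
have [r rC rE] := extend_hom hY cY (dense_preim po pT Ad) chiC.
apply: (splits_of_retraction ts rC) => y.
by rewrite -[i y]/(val (corestrict iH y)) rE /= Phi_i.
Qed.

Theorem corollary2p11 (R : realType) (G : topologicalZmodType)
    (A : zmodClosed G) (A_dense : dense [set x : G | x \in A])
    (SA : S_TG (circle R) (subgroup A)) :
  S_TG (circle R) G.
Proof.
apply: S_TG_dense A_dense SA; first exact: circle_hausdorff.
exact: circle_complete.
Qed.
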